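(* Let $k\ge1$ and let $v$ and $w$ be permutations in $S_\infty$. There is at most one saturated chain in the $k$-Bruhat order from $v$ to $w$, $$v=v_0\xrightarrow{(a_1,b_1)}v_1\xrightarrow{(a_2,b_2)}\cdots\xrightarrow{(a_q,b_q)}v_q=w,$$ that satisfies both of the following conditions: (P0) for $i=2,\ldots,q-1$, if $a_j=a_i$ for some $j<i$, then $(a_i,b_i)\prec(a_{i+1},b_{i+1})$; (P1) $b_1\ge b_2\ge\cdots\ge b_q$.
   Context: $S_\infty=\bigcup_n S_n$ under the usual inclusions; $\ell(w)$ is the number of inversions of $w$; $w(a,b)$ is obtained from $w$ by exchanging the values in positions $a$ and $b$. The $k$-Bruhat order is the suborder of the Bruhat order on $S_\infty$ whose covers are $u\lessdot u(a,b)$ with $a\le k<b$ and $\ell(u(a,b))=\ell(u)+1$; such a cover is written $u\xrightarrow{(a,b)}u(a,b)$. On pairs of positive integers, $(a,b)\prec(c,d)$ means: $b>d$, or $b=d$ and $a<c$. *)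

(* Defs.v *)
From HB Require Import structures.
From mathcomp Require Import all_boot finmap.

Set Implicit Arguments.
Unset Strict Implicit.
Unset Printing Implicit Defensive.

(* Positions and values are 1-based, as elements of nat: a member of S_oo is a
   permutation of nat that fixes 0 and all but finitely many positive integers.
   For a finitely supported function, injectivity already gives bijectivity. *)
Record Sinf := MkSinf {
  Sinf_fun :> {fsfun nat -> nat};
  Sinf_perm : fsinjectiveb Sinf_fun && (Sinf_fun 0 == 0)
}.

HB.instance Definition _ := [isSub for Sinf_fun].
HB.instance Definition _ := [Choice of Sinf by <:].

Definition max_moved (w : Sinf) : nat := \max_(i <- finsupp w) i.

(* Inversions i < j with w j < w i; inversion_bound below shows that the
   restriction to positions at most max_moved w loses none of them (and
   position 0 is in none, since w 0 = 0). *)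
Definition ell (w : Sinf) : nat :=
  let n := max_moved w in
  #|[set p : 'I_n.+1 * 'I_n.+1 | (p.1 < p.2) && (w p.2 < w p.1)]|.

Definition exchange (w : Sinf) (a b : nat) : {fsfun nat -> nat} :=
  [fsfun w with a |-> w b, b |-> w a].

Definition kcover (k : nat) (u : Sinf) (ab : nat * nat) (u' : Sinf) : bool :=
  let: (a, b) := ab in
  [&& 0 < a, a <= k, k < b, Sinf_fun u' == exchange u a b & ell u' == (ell u).+1].

(* A chain v = v_0 -> v_1 -> ... -> v_q = w is encoded by the list of the
   pairs ((a_i, b_i), v_i) for i = 1, ..., q; it is empty when q = 0. *)
Fixpoint kchain (k : nat) (v w : Sinf) (c : seq ((nat * nat) * Sinf)) : bool :=
  if c is (ab, u) :: c' then kcover k v ab u && kchain k u w c' else v == w.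

Definition labels (c : seq ((nat * nat) * Sinf)) : seq (nat * nat) := unzip1 c.

Definition label_lt (x y : nat * nat) : bool :=
  (y.2 < x.2) || ((x.2 == y.2) && (x.1 < y.1)).

(* List indices are 0-based: the index i.+1 < size s below is the bound
   i <= q - 1 for 1-based indices, and j < i forces i >= 2. *)
Definition condP0 (s : seq (nat * nat)) : Prop :=
  forall i, i.+1 < size s ->
    (exists2 j, j < i & (nth (0, 0) s j).1 = (nth (0, 0) s i).1) ->
    label_lt (nth (0, 0) s i) (nth (0, 0) s i.+1).

Definition condP1 (s : seq (nat * nat)) : Prop := sorted geq (unzip2 s).

Lemma Sinf_inj (w : Sinf) : injective w.
Proof. by case: w => f /= /andP[/fsinjectiveP]. Qed.

Lemma Sinf0 (w : Sinf) : w 0 = 0.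
Proof. by case: w => f /= /andP[_ /eqP]. Qed.

Lemma max_moved_id (w : Sinf) i : max_moved w < i -> w i = i.
Proof.
move=> lt_i; apply: fsfun_dflt; apply: contraL lt_i => i_supp.
by rewrite -leqNgt /max_moved (big_rem i i_supp) /= leq_maxl.
Qed.

Lemma inversion_bound (w : Sinf) i j :
  i < j -> w j < w i -> j <= max_moved w.
Proof.
move=> ij wji; case: leqP => // lt_j.
move: wji; rewrite (max_moved_id lt_j) => lt_wi.
have := max_moved_id (ltn_trans lt_j lt_wi) => /(@Sinf_inj w) wi.
by move: lt_wi; rewrite wi ltnNge (ltnW ij).
Qed.

Lemma exchange_perm (w : Sinf) a b : 0 < a -> 0 < b ->
  fsinjectiveb (exchange w a b) && (exchange w a b 0 == 0).
Proof.
have exE z : exchange w a b z = if z == a then w b else if z == b then w a else w z.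
  by rewrite /exchange !fsfun_withE.
move=> a0 b0; apply/andP; split; last first.
  by rewrite exE (ltn_eqF a0) (ltn_eqF b0) Sinf0.
apply/fsinjectiveP => x y; rewrite !exE.
by do ?[case: eqP => ?]; move=> /(@Sinf_inj w) ?; congruence.
Qed.

(* Main.v *)
Require Import Defs.
From mathcomp Require Import all_boot finmap.
From mathcomp Require Import zify.

(** Along a chain the values in positions at most [k] only increase and those
    in positions beyond [k] only decrease, so with (P1) the first exchanged
    position [b] is the largest one at which [v] and [w] differ
    ([first_position_le]).  Since (P0) and (P1) pass to the tail of a chain, it
    remains to see that two chains from [v] to [w] start with the same [a].

    Suppose that they start with [(a, b)] and [(a', b)], where [a < a'], and let
    [beta = v b].  The first chain lifts position [a] to the value [beta] at
    once, so [beta <= w a].  In the second chain, position [a'] receives [beta]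
    and then stands as a barrier in front of [a] ([barrier]): position [a] can
    only reach a value at least [beta] by an exchange with some position [e]
    whose value lies between [beta] and the current value of [a'], because a
    cover never jumps over the value of an intermediate position.  No [e]
    carries such a value when its turn comes, as [a'] cannot have jumped over
    it.  While [e] is being processed its value may drop into that range, but
    only through an exchange with [a'] or with a position right of [a'] that was
    used before; (P0) then forces all exchanges at [e] to stay right of [a']
    until the value of [e] is below [beta].  Hence [w a < beta], a
    contradiction. *)

Set Implicit Arguments.
Unset Strict Implicit.

(** * Covers of the Bruhat order *)

Definition inversion (w : nat -> nat) (p : nat * nat) : bool :=
  (p.1 < p.2) && (w p.2 < w p.1).

Definition inversions (w : Sinf) : seq (nat * nat) :=
  let n := max_moved w in
  [seq (val p.1, val p.2) | p in
    [set p : 'I_n.+1 * 'I_n.+1 | (p.1 < p.2) && (w p.2 < w p.1)]].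

Lemma size_inversions (w : Sinf) : size (inversions w) = ell w.
Proof. by rewrite size_map -cardE. Qed.

Lemma inversions_uniq (w : Sinf) : uniq (inversions w).
Proof.
rewrite map_inj_uniq ?enum_uniq // => -[i j] [i' j'] /= [] ? ?.
by congr (_, _); apply: val_inj.
Qed.

Lemma mem_inversions (w : Sinf) p : (p \in inversions w) = inversion w p.
Proof.
apply/mapP/idP => [[q] | ].
  by rewrite mem_enum inE => inv_q ->.
case: p => i j /andP[/= lt_ij inv_ij].
have le_j := inversion_bound lt_ij inv_ij.
have lt_i : i < (max_moved w).+1 by lia.
exists (Ordinal lt_i, Ordinal (le_j : j < (max_moved w).+1)) => //.
by rewrite mem_enum inE /= lt_ij.
Qed.

Definition swap (a b x : nat) : nat :=
  if x == a then b else if x == b then a else x.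

Lemma swapK a b : involutive (swap a b).
Proof. by move=> x; rewrite /swap; do ?case: eqP => //; lia. Qed.

Lemma exchangeE (w : Sinf) a b x : exchange w a b x = w (swap a b x).
Proof. by rewrite /exchange /swap !fsfun_withE; do ?case: eqP. Qed.

(** The inversion of [w \o swap a b] matched with an inversion [p] of [w]: the
    swapped pair whenever it is still increasing, and otherwise [p], which is
    then an inversion of both. *)
Definition transport (a b : nat) (p : nat * nat) : nat * nat :=
  let q := (swap a b p.1, swap a b p.2) in if q.1 < q.2 then q else p.

Lemma transport_inversion (w w' : nat -> nat) a b p :
  (forall x, w' x = w (swap a b x)) -> a < b -> w a < w b ->
  inversion w p -> inversion w' (transport a b p).
Proof.
move=> w'E lt_ab lt_w; case: p => i j /andP[/= lt_ij inv_ij].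
rewrite /inversion /transport /=; case: ifP => lt_s /=.
  by rewrite lt_s !w'E !swapK.
rewrite lt_ij !w'E /=; move: lt_s; rewrite /swap.
by do ?case: eqP => ? //; subst; lia.
Qed.

Lemma transport_inj a b (p q : nat * nat) : p.1 < p.2 -> q.1 < q.2 ->
  transport a b p = transport a b q -> p = q.
Proof.
case: p q => [i j] [i' j'] /= lt_p lt_q; rewrite /transport /=.
case: ifP => lt_sp; case: ifP => lt_sq [ei ej] //.
- by rewrite -(swapK a b i) -(swapK a b j) ei ej !swapK.
- by move: lt_sq; rewrite -ei -ej !swapK lt_p.
- by move: lt_sp; rewrite ei ej !swapK lt_q.
- by rewrite ei ej.
Qed.

Lemma transport_missed (w : nat -> nat) a b p q :
  inversion w p -> ~~ inversion w q -> swap a b q.2 <= swap a b q.1 ->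
  transport a b p <> q.
Proof.
move=> inv_p ninv_q sq e; move: (inv_p) => /andP[lt_p _].
move: e; rewrite /transport; case: ifP => _ e; subst q.
  by move: sq; rewrite /= !swapK leqNgt lt_p.
by rewrite inv_p in ninv_q.
Qed.

(** The transported inversions of [w] are distinct inversions of [w'];
    each inversion of [w'] missed by transport, such as [(a, b)], adds one
    more. *)
Lemma ell_exchange_ge (w w' : Sinf) a b (s : seq (nat * nat)) :
  (forall x, w' x = w (swap a b x)) -> a < b -> w a < w b -> uniq s ->
  (forall q, q \in s ->
     [&& inversion w' q, ~~ inversion w q & swap a b q.2 <= swap a b q.1]) ->
  size s + ell w <= ell w'.
Proof.
move=> w'E lt_ab lt_w s_uniq sP; rewrite -!size_inversions.
rewrite -(size_map (transport a b) (inversions w)) -size_cat.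
apply: uniq_leq_size => [|q]; last first.
  rewrite mem_cat mem_inversions => /orP[/sP/and3P[] //|/mapP[p]].
  by rewrite mem_inversions => inv_p ->; apply: transport_inversion.
rewrite cat_uniq s_uniq /=; apply/andP; split; last first.
  rewrite map_inj_in_uniq ?inversions_uniq // => p q.
  by rewrite !mem_inversions => /andP[? _] /andP[? _]; apply: transport_inj.
apply/hasPn => q /mapP[p]; rewrite mem_inversions => inv_p eq_q.
apply/negP => /sP/and3P[_ ninv_q sq].
exact: (transport_missed inv_p ninv_q sq (esym eq_q)).
Qed.

Lemma kcover_le k u a b u' : kcover k u (a, b) u' -> a <= k < b.
Proof. by case/and5P => _ -> ->. Qed.

Lemma kcoverE k u a b u' x : kcover k u (a, b) u' -> u' x = u (swap a b x).
Proof. by case/and5P => _ _ _ /eqP -> _; rewrite exchangeE. Qed.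

(** If [u b < u a], then [u] is obtained from [u'] by exchanging two values in
    increasing order, so it has at least the length of [u']. *)
Lemma kcover_lt k u a b u' : kcover k u (a, b) u' -> u a < u b.
Proof.
move=> cov; have /andP[ak kb] := kcover_le cov; have lt_ab : a < b by lia.
have /and5P[_ _ _ _ /eqP ellE] := cov.
have u'E x := kcoverE x cov.
case: (ltngtP (u a) (u b)) => // [lt_u | /Sinf_inj]; last by lia.
have uE x : u x = u' (swap a b x) by rewrite u'E swapK.
have lt_u' : u' a < u' b by rewrite !u'E /swap !eqxx; case: eqP => // e; lia.
suff : size (Nil (nat * nat)) + ell u' <= ell u by rewrite /= ellE; lia.
exact: ell_exchange_ge uE lt_ab lt_u' _ _.
Qed.

(** Otherwise [(a, b)] and [(a, c)] would be two inversions missed by the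
    transport, and the length would grow by at least 2. *)
Lemma kcover_gap k u a b u' c : kcover k u (a, b) u' ->
  a < c < b -> u c < u a \/ u b < u c.
Proof.
move=> cov /andP[lt_ac lt_cb]; have lt_u := kcover_lt cov.
have /andP[ak kb] := kcover_le cov; have lt_ab : a < b by lia.
have /and5P[_ _ _ _ /eqP ellE] := cov.
have u'E x := kcoverE x cov.
case: (ltngtP (u c) (u a)) => [|lt_uac|/Sinf_inj]; [by left| |by lia].
case: (ltngtP (u b) (u c)) => [|lt_ucb|/Sinf_inj]; [by right| |by lia].
suff : size [:: (a, b); (a, c)] + ell u <= ell u' by rewrite /= ellE; lia.
have [sa sb sc] : [/\ swap a b a = b, swap a b b = a & swap a b c = c].
  by rewrite /swap !eqxx; split; do ?case: eqP => ?; lia.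
apply: (ell_exchange_ge u'E lt_ab lt_u).
  by rewrite /= inE andbT; apply/eqP => -[]; lia.
move=> q; rewrite !inE => /orP[] /eqP ->;
  rewrite /inversion /= !u'E sa ?sb ?sc; lia.
Qed.

Lemma kcover_left k u a b u' : kcover k u (a, b) u' -> u' a = u b.
Proof. by move=> cov; rewrite (kcoverE _ cov) /swap eqxx. Qed.

Lemma kcover_right k u a b u' : kcover k u (a, b) u' -> u' b = u a.
Proof.
by move=> cov; rewrite (kcoverE _ cov) /swap eqxx; case: eqP => // ->.
Qed.

Lemma kcover_other k u a b u' x : kcover k u (a, b) u' ->
  x <> a -> x <> b -> u' x = u x.
Proof.
by move=> cov xa xb; rewrite (kcoverE _ cov) /swap; do 2!case: eqP => //.
Qed.

(** * Values along a chain *)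

Lemma kchain_left_le k v w c x : kchain k v w c -> x <= k -> v x <= w x.
Proof.
elim: c v => [|[[a b] u] c IH] v /=; first by move=> /eqP ->.
case/andP => cov ch xk; have := IH _ ch xk.
have le_k := kcover_le cov; have := kcover_lt cov; have := kcover_left cov.
case: (x =P a) => [->|xa]; first by lia.
by rewrite (kcover_other (x := x) cov) //; lia.
Qed.

Lemma kchain_right_ge k v w c x : kchain k v w c -> k < x -> w x <= v x.
Proof.
elim: c v => [|[[a b] u] c IH] v /=; first by move=> /eqP ->.
case/andP => cov ch xk; have := IH _ ch xk.
have le_k := kcover_le cov; have := kcover_lt cov; have := kcover_right cov.
case: (x =P b) => [->|xb]; first by lia.
by rewrite (kcover_other (x := x) cov) //; lia.
Qed.

Lemma kchain_untouched k v w c x : kchain k v w c -> k < x ->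
  all (fun b => b < x) (unzip2 (labels c)) -> w x = v x.
Proof.
elim: c v => [|[[a b] u] c IH] v /=; first by move=> /eqP ->.
case/andP => cov ch xk /andP[lt_bx lt_cx]; rewrite (IH _ ch) //.
by have := kcover_le cov => ?; apply: (kcover_other cov); lia.
Qed.

Lemma kchain_head_lt k v w a b u c :
  kchain k v w (((a, b), u) :: c) -> w b < v b.
Proof.
case/andP => cov ch; have /andP[_ kb] := kcover_le cov.
have := kchain_right_ge ch kb.
by rewrite (kcover_right cov); have := kcover_lt cov; lia.
Qed.

Lemma first_position_le k v w a1 b1 u1 c1 a2 b2 u2 c2 :
  kchain k v w (((a1, b1), u1) :: c1) ->
  condP1 (labels (((a1, b1), u1) :: c1)) ->
  kchain k v w (((a2, b2), u2) :: c2) -> b2 <= b1.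
Proof.
move=> ch1 /= P1 ch2; rewrite leqNgt; apply/negP => lt_b.
have /andP[/kcover_le/andP[_ kb2] _] := ch2.
have := kchain_head_lt ch2.
rewrite (kchain_untouched ch1 kb2) ?ltnn //= lt_b /=.
have geq_trans : transitive geq by move=> x y z /=; lia.
by apply: sub_all (order_path_min geq_trans P1) => x /=; lia.
Qed.

(** * Condition (P0) *)

(** (P0) read from left to right, where [A] collects the first entries of the
    labels already passed. *)
Fixpoint P0_after (A : seq nat) (s : seq (nat * nat)) : Prop :=
  if s is x :: s' then
    (if s' is y :: _ then x.1 \in A -> label_lt x y : Prop else True)
    /\ P0_after (x.1 :: A) s'
  else True.

Lemma condP0_after A s :
  (forall i, i.+1 < size s ->
     (nth (0, 0) s i).1 \in A \/
     (exists2 j, j < i & (nth (0, 0) s j).1 = (nth (0, 0) s i).1) ->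
     label_lt (nth (0, 0) s i) (nth (0, 0) s i.+1)) ->
  P0_after A s.
Proof.
elim: s A => [|x s IH] A //= sP; split.
  by case: s sP {IH} => [//|y s] sP xA; apply: (sP 0) => //; left.
apply: IH => i lt_i hi; apply: (sP i.+1) => //.
case: hi => [|[j lt_j eq_j]]; last by right; exists j.+1.
by rewrite inE => /orP[/eqP ->|]; [right; exists 0 | left].
Qed.

Lemma condP0_tail x s : condP0 (x :: s) -> condP0 s.
Proof.
move=> P0 i lt_i [j lt_j eq_j]; apply: (P0 i.+1) => //.
by exists j.+1.
Qed.

(** * The barrier *)

(** The last label applied is [(c0, b0)], and [A] lists the first entries of
    the labels before it.  No value in the range from [beta] up to that of [a']
    can be found in a position that may still be exchanged with [a], except
    in [b0] when (P0) keeps the next exchanges at [b0] right of [a'].  Unused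
    positions right of [a'] avoid the same range; without this, exchanging [b0]
    with one of them would put such a value in [b0] while (P0) imposes
    nothing. *)
Lemma barrier_invariant k w a a' beta c u A c0 b0 :
  a < a' -> a' <= k ->
  kchain k u w c -> P0_after A ((c0, b0) :: labels c) ->
  path geq b0 (unzip2 (labels c)) ->
  a' \in c0 :: A -> u a < beta -> beta <= u a' ->
  (forall d, a' < d <= k -> d \notin c0 :: A -> u d < beta \/ u a' < u d) ->
  (forall d, k < d < b0 -> u d < beta \/ u a' < u d) ->
  [\/ u b0 < beta, u a' < u b0 | a' <= c0 /\ c0 \in A] ->
  w a < beta.
Proof.
move=> lt_a le_a'.
elim: c u A c0 b0 => [|[[d e] u'] c IH] u A c0 b0 /=; first by move=> /eqP ->.
case/andP => cov ch [P0 P0c] /andP[/= le_e Pc] a'A ua ua' fresh ahead cur.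
have /andP[dk ke] := kcover_le cov.
have ltu := kcover_lt cov.
have gap x := kcover_gap (c := x) cov.
have u'd := kcover_left cov.
have u'e := kcover_right cov.
have u'o x := kcover_other (x := x) cov.
(* In the remaining case of [cur], (P0) sends this exchange right of [a'] or to
   a position [e < b0]; an [e < b0] is covered by [ahead]. *)
have cur_e : [\/ u e < beta, u a' < u e | a' < d].
  have [lt_e | eq_e] : e < b0 \/ e = b0 by lia.
    by case: (ahead e) => [|?|?]; [lia | constructor 1 | constructor 2].
  move: P0 cur; rewrite eq_e => P0 [? | ? | [le_c0 /P0]];
    [by constructor 1 | by constructor 2 | ].
  by rewrite /label_lt /= => ?; constructor 3; lia.
have u'a' : d <> a' -> u' a' = u a' by move=> ?; apply: u'o; lia.
(* Only an exchange at [a'] itself moves the upper end of the range, and it does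
   not jump over the value of an intermediate position. *)
have avoid x : a' < x < e -> x <> d -> u x < beta \/ u a' < u x ->
    u' x < beta \/ u' a' < u' x.
  move=> lt_x xd; rewrite (u'o x); [|lia|lia].
  case: (d =P a') => [eq_d|/u'a' -> //]; have := gap x.
  by move: u'd; rewrite eq_d => ->; lia.
apply: (IH u' (c0 :: A) d e) => //.
- by rewrite inE a'A orbT.
- case: (a =P d) => [eq_a | ad]; last by rewrite u'o //; lia.
  by have := gap a'; rewrite eq_a in ua lt_a *; rewrite u'd; case: cur_e; lia.
- case: (d =P a') => [eq_d | /u'a' -> //].
  by move: u'd ltu; rewrite eq_d => ->; lia.
- move=> x lt_x; rewrite inE negb_or => /andP[/eqP xd xA].
  by apply: avoid => //; [lia | apply: fresh].
- by move=> x lt_x; apply: avoid; [lia | lia | apply: ahead; lia].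
- (* A position left of [a'] takes the value of [e] from above [a'] only if its
     own value is above [a'] too; a used position right of [a'], or [a'] itself,
     may let the value of [e] drop into the range, but then (P0) applies. *)
  rewrite u'e; case: (ltngtP d a') => [lt_d | gt_d | eq_d].
  + rewrite u'a'; last lia.
    by have := gap a'; case: cur_e => ?;
      [constructor 1 | constructor 2 | exfalso]; lia.
  + case: (boolP (d \in c0 :: A)) => [dA | dA].
      by constructor 3; split => //; lia.
    rewrite u'a'; last lia.
    by case: (fresh d) => // [|?|?]; [lia | constructor 1 | constructor 2].
  + by constructor 3; rewrite eq_d.
Qed.

Lemma barrier k v w a a' b u c :
  kchain k v w (((a', b), u) :: c) ->
  condP0 (labels (((a', b), u) :: c)) -> condP1 (labels (((a', b), u) :: c)) ->
  a < a' -> v a < v b -> w a < v b.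
Proof.
move=> /= /andP[cov ch] P0 P1 lt_a va.
have /andP[a'k kb] := kcover_le cov.
have lt_v := kcover_lt cov.
have u_a' := kcover_left cov.
have u_b := kcover_right cov.
have avoid x : a' < x < b -> u x < v b \/ u a' < u x.
  move=> lt_x; rewrite u_a' (kcover_other cov); [|lia|lia].
  by have := kcover_gap (c := x) cov; lia.
apply: (barrier_invariant lt_a a'k ch (A := [::]) (c0 := a') (b0 := b)) => //.
- by apply: condP0_after => i lt_i [//|]; apply: P0.
- by rewrite mem_head.
- by rewrite (kcover_other cov) //; lia.
- by rewrite u_a'.
- by move=> x lt_x _; apply: avoid; lia.
- by move=> x lt_x; apply: avoid; lia.
- by constructor 1; rewrite u_b.
Qed.

(** * Uniqueness *)

Lemma first_left_le k v w a1 b u1 c1 a2 u2 c2 :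
  kchain k v w (((a1, b), u1) :: c1) ->
  kchain k v w (((a2, b), u2) :: c2) ->
  condP0 (labels (((a2, b), u2) :: c2)) ->
  condP1 (labels (((a2, b), u2) :: c2)) ->
  a2 <= a1.
Proof.
move=> /= /andP[cov1 ch1] ch2 P0 P1; rewrite leqNgt; apply/negP => lt_a.
have /andP[a1k _] := kcover_le cov1.
have := barrier ch2 P0 P1 lt_a (kcover_lt cov1).
have := kchain_left_le ch1 a1k.
by rewrite (kcover_left cov1); lia.
Qed.

Unset Implicit Arguments.

Theorem theorem2 (k : nat) (hk : 1 <= k) (v w : Sinf)
    (c1 c2 : seq ((nat * nat) * Sinf)) :
  kchain k v w c1 -> condP0 (labels c1) -> condP1 (labels c1) ->
  kchain k v w c2 -> condP0 (labels c2) -> condP1 (labels c2) ->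
  c1 = c2.
Proof.
elim: c1 v c2 => [|[[a1 b1] u1] c1 IH] v [|[[a2 b2] u2] c2] //.
- by move=> /= /eqP <- _ _ /kchain_head_lt; rewrite ltnn.
- by move=> /kchain_head_lt lt_w _ _ /= /eqP eq_v; rewrite eq_v ltnn in lt_w.
move=> ch1 P01 P11 ch2 P02 P12.
have eq_b : b1 = b2.
  by apply/eqP; rewrite eqn_leq (first_position_le ch1 P11 ch2)
    (first_position_le ch2 P12 ch1).
subst b2.
have eq_a : a1 = a2.
  by apply/eqP; rewrite eqn_leq (first_left_le ch1 ch2 P02 P12)
    (first_left_le ch2 ch1 P01 P11).
subst a2.
move: ch1 ch2 => /= /andP[cov1 ch1] /andP[cov2 ch2].
have eq_u : u1 = u2.
  have /and5P[_ _ _ /eqP u1E _] := cov1.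
  have /and5P[_ _ _ /eqP u2E _] := cov2.
  by apply: val_inj; apply: etrans u1E (esym u2E).
subst u2; congr (_ :: _).
apply: (IH u1) => //; first exact: condP0_tail P01.
- exact: path_sorted P11.
- exact: condP0_tail P02.
- exact: path_sorted P12.
Qed.
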